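(* Let $(\mathcal{A},m)$ be a nonempty multiarrangement in an $\ell$-dimensional vector space $V$ over a field $\mathbb{K}$ with $\ell\ge 2$, let $H_0\in\mathcal{A}$ have defining form $\alpha_0$, and let $(\mathcal{A}',m')$ be the deletion of $(\mathcal{A},m)$ with respect to $H_0$. If $(\mathcal{A},m)$ and $(\mathcal{A}',m')$ are both free, then there exists a basis $\{\theta_1,\ldots,\theta_\ell\}$ for $D(\mathcal{A}',m')$ such that, for some $k\in\{1,\ldots,\ell\}$, $\{\theta_1,\ldots,\theta_{k-1},\alpha_0\theta_k,\theta_{k+1},\ldots,\theta_\ell\}$ is a basis for $D(\mathcal{A},m)$.
   Context: Let $\mathbb{K}$ be a field, $V$ an $\ell$-dimensional $\mathbb{K}$-vector space, $S=\mathrm{Sym}(V^* )\cong\mathbb{K}[x_1,\ldots,x_\ell]$, and $\mathrm{Der}_{\mathbb{K}}(S)=\bigoplus_i S\,\partial_{x_i}$ the $S$-module of $\mathbb{K}$-linear derivations of $S$. An arrangement is a finite set $\mathcal{A}$ of hyperplanes of $V$, all containing the origin; for each $H\in\mathcal{A}$ fix a linear form $\alpha_H$ with $H=\ker\alpha_H$. A multiarrangement $(\mathcal{A},m)$ is an arrangement with a multiplicity $m:\mathcal{A}\to\mathbb{Z}_{>0}$. Define $D(\mathcal{A},m)=\{\theta\in\mathrm{Der}_{\mathbb{K}}(S)\mid\theta(\alpha_H)\in\alpha_H^{m(H)}S\text{ for all }H\in\mathcal{A}\}$; $(\mathcal{A},m)$ is free if $D(\mathcal{A},m)$ is a free $S$-module.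 Deletion with respect to $H_0\in\mathcal{A}$: if $m(H_0)=1$, then $\mathcal{A}'=\mathcal{A}\setminus\{H_0\}$ and $m'=m|_{\mathcal{A}'}$; if $m(H_0)\ge2$, then $\mathcal{A}'=\mathcal{A}$, $m'(H)=m(H)$ for $H\ne H_0$, and $m'(H_0)=m(H_0)-1$. *)

(* Defs.v *)
From HB Require Import structures.
From mathcomp Require Import all_boot all_order all_algebra.
From mathcomp Require Import finmap mpoly.

Set Implicit Arguments.
Unset Strict Implicit.
Unset Printing Implicit Defensive.

Import GRing.Theory.
Local Open Scope fset_scope.
Local Open Scope ring_scope.

(* Bases are families indexed by an arbitrary, possibly infinite, set, so that
   [is_free] does not build in finite generation. *)
Definition is_basis (R : nzRingType) (M : lmodType R) (D : M -> Prop)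
    (I : eqType) (b : I -> M) : Prop :=
  [/\ forall i, D (b i),
      forall x, D x -> exists (s : seq I) (c : I -> R),
        x = \sum_(i <- s) c i *: b i
    & forall (s : seq I) (c : I -> R), uniq s ->
        \sum_(i <- s) c i *: b i = 0 -> forall i, i \in s -> c i = 0].

Definition is_free (R : nzRingType) (M : lmodType R) (D : M -> Prop) : Prop :=
  exists (I : eqType) (b : I -> M), is_basis D b.

(* S = Sym(V^* ) is {mpoly K[l]}, where 'X_i is the i-th coordinate function
   with respect to a chosen basis e of V; this is the image in S of a linear
   form a : V -> K. *)
Definition form_poly (K : fieldType) (V : vectType K) (l : nat)
    (e : l.-tuple V) (a : 'Hom(V, K^o)) : {mpoly K[l]} :=
  \sum_(i < l) (a (tnth e i) : K) *: 'X_i.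

(* The row t stands for the derivation \sum_i t_i d/dx_i of S, so that the
   S-module Der_K(S) is 'rV[S]_l. *)
Definition der_app (K : fieldType) (l : nat) (t : 'rV[{mpoly K[l]}]_l)
    (f : {mpoly K[l]}) : {mpoly K[l]} :=
  \sum_(i < l) t 0 i * f^`M(i).

(* The values of m outside A are irrelevant. *)
Definition is_multiarrangement (K : fieldType) (V : vectType K)
    (A : {fset {vspace V}}) (m : {vspace V} -> nat) : Prop :=
  forall H, H \in A -> (\dim H).+1 = \dim {:V} /\ (0 < m H)%N.

Definition defining_forms (K : fieldType) (V : vectType K)
    (A : {fset {vspace V}}) (alpha : {vspace V} -> 'Hom(V, K^o)) : Prop :=
  forall H, H \in A -> lker (alpha H) = H.

Definition logder (K : fieldType) (V : vectType K) (l : nat)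
    (e : l.-tuple V) (alpha : {vspace V} -> 'Hom(V, K^o))
    (A : {fset {vspace V}}) (m : {vspace V} -> nat)
    (t : 'rV[{mpoly K[l]}]_l) : Prop :=
  forall H, H \in A -> exists g : {mpoly K[l]},
    der_app t (form_poly e (alpha H)) = form_poly e (alpha H) ^+ m H * g.

Definition del_arr (K : fieldType) (V : vectType K)
    (A : {fset {vspace V}}) (m : {vspace V} -> nat) (H0 : {vspace V}) :
    {fset {vspace V}} :=
  if m H0 == 1%N then A `\ H0 else A.

Definition del_mult (K : fieldType) (V : vectType K)
    (m : {vspace V} -> nat) (H0 : {vspace V}) : {vspace V} -> nat :=
  fun H => if H == H0 then (m H0).-1 else m H.

(* Main.v *)
(* Fix bases B, B' of D = D(A, m) and D' = D(A', m').  Since D is contained in D'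
   and a D' in D, where a = alpha_0, one has B = M B' and a B' = N B with
   M N = N M = a.  As D and D' are graded, B and B' may be taken homogeneous, and
   then homogeneous elements form a basis as soon as their coefficient matrix is
   invertible at the origin.  Evaluating M N = a and its derivative at the origin
   yields rank M(0) + rank N(0) = l.  Choose a maximal independent set of rows of
   M(0) and one of N(0): the corresponding elements phi_f of B and eta_g of B' are
   such that (phi_f, eta_g) is a basis of D' and (phi_f, a eta_g) a basis of D.
   Hence D' / D is free over S / a on the classes of the eta_g; being isomorphic to
   a nonzero ideal of S / a, it has rank one. *)

Require Import Defs.
From HB Require Import structures.
From mathcomp Require Import all_boot all_order all_algebra.
From mathcomp Require Import finmap mpoly perm.

Set Implicit Arguments.
Unset Strict Implicit.
Unset Printing Implicit Defensive.

Import GRing.Theory.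
Local Open Scope fset_scope.
Local Open Scope ring_scope.

(** * Linear algebra over a domain; bases as square matrices *)

Lemma left_kernel_vector (R : idomainType) (p q : nat) (A : 'M[R]_(p, q)) :
  (q < p)%N -> exists2 v : 'rV_p, v != 0 & v *m A = 0.
Proof.
move=> qp.
(* Padding with zero columns gives a square matrix; column [q] is zero, so its determinant vanishes,
   and a kernel vector of [A'] also kills [A]. *)
pose A' : 'M[R]_p := \matrix_(i, j) oapp (A i) 0 (insub (val j)).
have /det0P[v v0 vA'] : \det A' == 0.
  rewrite -det_tr; apply/det0P; exists (delta_mx 0 (Ordinal qp)).
    by apply/eqP => /matrixP/(_ 0 (Ordinal qp))/eqP; rewrite !mxE !eqxx oner_eq0.
  by rewrite -rowE; apply/rowP => i; rewrite !mxE insubF //= ltnn.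
exists v => //; apply/rowP => j.
have jp : (j < p)%N by apply: ltn_trans qp.
move/rowP/(_ (Ordinal jp)): vA'; rewrite !mxE => {2}<-.
apply: eq_bigr => i _; congr (_ * _); rewrite !mxE /=.
by rewrite insubT //= => lt; congr (A i _); apply: val_inj.
Qed.

Lemma mulmx_det_inj (R : idomainType) (l n : nat) (B : 'M[R]_l) (u v : 'M_(n, l)) :
  \det B != 0 -> u *m B = v *m B -> u = v.
Proof.
move=> dB /(congr1 (mulmx^~ (\adj B))); rewrite -!mulmxA mul_mx_adj.
by rewrite !mul_mx_scalar => /(scalemx_inj dB).
Qed.

(** The basis elements are the rows of a square matrix, so that a change of basis is a left
    multiplication and determinants become available. *)
Definition mx_basis (R : nzRingType) (l : nat) (D : 'rV[R]_l -> Prop)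
    (B : 'M[R]_l) : Prop :=
  [/\ forall i, D (row i B),
      forall x, D x -> exists c : 'rV_l, x = c *m B
    & forall v : 'rV_l, v *m B = 0 -> v = 0].

Lemma mx_basis_det (R : idomainType) (l : nat) (D : 'rV[R]_l -> Prop)
    (B : 'M[R]_l) : mx_basis D B -> \det B != 0.
Proof.
by case=> _ _ frB; apply/negP => /det0P[v v0 /frB]; apply/eqP.
Qed.

Lemma mx_basis_mul (R : idomainType) (l n : nat) (D : 'rV[R]_l -> Prop)
    (B : 'M[R]_l) (X : 'M_(n, l)) :
  mx_basis D B -> (forall i, D (row i X)) -> exists C : 'M_(n, l), X = C *m B.
Proof.
move=> [_ genB _] DX.
have /fin_all_exists[c Xc] i : exists c : 'rV_l, row i X = c *m B.
  exact: genB.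
by exists (\matrix_i c i); apply/row_matrixP => i; rewrite row_mul rowK.
Qed.

Lemma mx_basis_unit (R : idomainType) (l : nat) (D : 'rV[R]_l -> Prop)
    (B C : 'M[R]_l) :
  mx_basis D B -> C \in unitmx -> (forall i, D (row i (C *m B))) ->
  mx_basis D (C *m B).
Proof.
move=> bB uC DCB; have dB := mx_basis_det bB; case: bB => DB genB frB.
split=> // [x /genB[c ->] | v].
  by exists (c *m invmx C); rewrite mulmxA mulmxKV.
by rewrite mulmxA => /frB/(congr1 (mulmx^~ (invmx C))); rewrite mulmxK // mul0mx.
Qed.

Lemma mx_basis_is_basis (R : idomainType) (l : nat) (D : 'rV[R]_l -> Prop)
    (B : 'M[R]_l) (b : 'I_l -> 'rV[R]_l) :
  mx_basis D B -> (forall i, b i = row i B) -> is_basis D b.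
Proof.
move=> [DB genB frB] bE; split=> [i | x /genB[c ->] | s c us].
- by rewrite bE.
- exists (index_enum 'I_l), (fun i => c 0 i).
  by rewrite mulmx_sum_row; apply: eq_bigr => i _; rewrite bE.
- move=> sum0 i si; suff /rowP/(_ i): \row_j (if j \in s then c j else 0) = 0.
    by rewrite !mxE si.
  move: sum0; rewrite big_uniq //= big_mkcond /= => sum0.
  apply: frB; rewrite mulmx_sum_row -[RHS]sum0.
  apply: eq_bigr => j _; rewrite mxE bE.
  by case: ifP; rewrite ?scale0r.
Qed.

(** Repeated indices of [s] are merged and missing ones get coefficient zero, so that all
    combinations can be written along one duplicate-free list. *)
Lemma sum_uniq_support (R : nzRingType) (M : lmodType R) (I : eqType) (b : I -> M)
    (s u : seq I) (c : I -> R) : uniq u -> {subset s <= u} ->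
  exists c', \sum_(i <- s) c i *: b i = \sum_(i <- u) c' i *: b i.
Proof.
move=> uu; elim: s => [|x s IH] su.
  by exists (fun=> 0); rewrite big_nil big1 // => i _; rewrite scale0r.
have [|c' sE] := IH; first by move=> i si; apply: su; rewrite inE si orbT.
have xu : x \in u by apply: su; rewrite inE eqxx.
exists (fun i => c' i + (if i == x then c x else 0)).
rewrite big_cons sE; under [RHS]eq_bigr do rewrite scalerDl.
rewrite big_split /= addrC; congr (_ + _).
rewrite (bigD1_seq x) //= eqxx big1 ?addr0 // => i /negPf->.
by rewrite scale0r.
Qed.

Definition tuple_mx (R : nzRingType) (l n : nat) (I : Type) (b : I -> 'rV[R]_l)
  (u : n.-tuple I) : 'M[R]_(n, l) := \matrix_i b (tnth u i).

Lemma sum_tuple_mx (R : nzRingType) (l n : nat) (I : Type) (b : I -> 'rV[R]_l)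
    (u : n.-tuple I) (c : I -> R) :
  \sum_(i <- u) c i *: b i = (\row_k c (tnth u k)) *m tuple_mx b u.
Proof.
rewrite mulmx_sum_row big_tuple; apply: eq_bigr => i _.
by rewrite mxE rowK.
Qed.

Lemma tuple_mx_free (R : nzRingType) (l n : nat) (D : 'rV[R]_l -> Prop)
    (I : eqType) (b : I -> 'rV[R]_l) (u : n.-tuple I) (v : 'rV_n) :
  is_basis D b -> uniq u -> v *m tuple_mx b u = 0 -> v = 0.
Proof.
move=> [_ _ fr] uu v0; apply/rowP => k; rewrite mxE.
have i0 := tnth u k.
(* As [u] has no repetition, [index] inverts [tnth u]; the default 0 is never reached on [u]. *)
pose c i := oapp (v 0) 0 (insub (index i u)).
have cE j : c (tnth u j) = v 0 j.
  by rewrite /c (tnth_nth i0) index_uniq ?size_tuple // valK.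
rewrite -cE; apply: (fr u) (mem_tnth _ _) => //.
by rewrite sum_tuple_mx -[RHS]v0; congr (_ *m _); apply/rowP => j; rewrite mxE cE.
Qed.

(* A basis indexed by an arbitrary type has exactly [l] elements as soon as the
   submodule contains a nonzero multiple of the free module of rank [l]. *)
Lemma is_free_mx_basis (R : idomainType) (l : nat) (D : 'rV[R]_l -> Prop) (Q : R) :
  Q != 0 -> (forall i, D (Q *: delta_mx 0 i)) -> is_free D ->
  exists B : 'M[R]_l, mx_basis D B.
Proof.
move=> Q0 DQ [I [b bb]].
have szle (u : seq I) : uniq u -> (size u <= l)%N.
  move=> uu; rewrite leqNgt; apply/negP.
  move=> /(left_kernel_vector (tuple_mx b (in_tuple u)))[v v0 vB].
  by move/eqP: v0; apply; exact: (tuple_mx_free (u := in_tuple u) bb uu vB).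
have [Db gen _] := bb.
have /fin_all_exists[s] i : exists s : seq I, exists c : I -> R,
    Q *: delta_mx 0 i = \sum_(j <- s) c j *: b j by exact: gen.
move=> /fin_all_exists[c sc].
pose u := undup (flatten [seq s i | i <- enum 'I_l]).
have uu : uniq u by exact: undup_uniq.
have su i : {subset s i <= u}.
  move=> x xs; rewrite mem_undup; apply/flattenP; exists (s i) => //.
  by apply: map_f; rewrite mem_enum.
(* [Q%:M] factors through [size u] rows; with fewer than [l] of them, some nonzero [v] would satisfy
   [Q *: v = 0]. *)
have szge : (l <= size u)%N.
  have /fin_all_exists[d dE] i : exists d : 'rV_(size u),
      Q *: delta_mx 0 i = d *m tuple_mx b (in_tuple u).
    have [c' c'E] := sum_uniq_support b (c i) uu (su i).
    by exists (\row_k c' (tnth (in_tuple u) k)); rewrite sc c'E -sum_tuple_mx.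
  have CE : Q%:M = (\matrix_i d i) *m tuple_mx b (in_tuple u).
    apply/row_matrixP => i; rewrite row_mul rowK -dE.
    by apply/rowP => j; rewrite !mxE eqxx /= mulr_natr eq_sym.
  rewrite leqNgt; apply/negP => /(left_kernel_vector (\matrix_i d i)).
  move=> [v /negP v0 vC]; apply: v0.
  have: Q *: v = 0 by rewrite -mul_mx_scalar CE mulmxA vC mul0mx.
  by move/eqP; rewrite scalemx_eq0 (negPf Q0).
have /eqP usz : size u = l by apply/anti_leq; rewrite szle.
(* An index outside [u] would extend it to a duplicate-free list of length [l + 1]. *)
have uall i : i \in u.
  apply/negPn/negP => iu; have := szle (i :: u).
  by rewrite /= iu uu (eqP usz) ltnn => /(_ isT).
exists (tuple_mx b (Tuple usz)); split=> [i | x /gen[t [a ->]] | v].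
- by rewrite rowK; exact: Db.
- have [a' ->] := sum_uniq_support (s := t) b a uu (fun i _ => uall i).
  by eexists; exact: (sum_tuple_mx b (Tuple usz)).
- exact: (tuple_mx_free (u := Tuple usz) bb uu).
Qed.

(** * Homogeneous bases *)

(** The monomial order refines the degree, so [mlast q] has least degree in the support of [q]; a
    nonconstant monomial of [p] can only contribute in strictly higher degree. *)
Lemma mcoeffM_mlast (l : nat) (K : idomainType) (p q : {mpoly K[l]}) :
  q != 0 -> (p * q)@_(mlast q) = p@_0 * q@_(mlast q).
Proof.
move=> q0; rewrite -[p in LHS](subrK (p@_0)%:MP) mulrDl mcoeffD mcoeffCM.
rewrite -[RHS]add0r; congr (_ + _).
apply/eqP; rewrite mcoeff_eq0; apply/negP => /msuppM_le/allpairsP[[m1 m2] /=].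
move=> [m1p m2q mE].
have m10 : m1 != 0%MM.
  by apply: contraTneq m1p => ->; rewrite mcoeff_msupp mcoeffB mcoeffC eqxx mulr1 subrr eqxx.
have := lemc_mdeg (mlast_lemc m2q); rewrite mE mdegD -{2}[mdeg m2]add0n leq_add2r.
by rewrite leqn0 mdeg_eq0 (negPf m10).
Qed.

(** The lowest degree in [p * q] is that of [mlast q] because [p] has a constant term, and the
    highest is the sum of the leading degrees; their equality forces [p] to have degree 0. *)
Lemma dhomog_left_factor (l d : nat) (K : idomainType) (p q : {mpoly K[l]}) :
  q != 0 -> p@_0 != 0 -> p * q \is d.-homog -> p = (p@_0)%:MP.
Proof.
move=> q0 p0 /dhomogP hpq; apply: msize1_polyC.
have pn0 : p != 0 by apply: contraNneq p0 => ->; rewrite mcoeff0.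
have pq0 : p * q != 0 by rewrite mulf_neq0.
have dlast : mdeg (mlast q) = d.
  apply: hpq; rewrite mcoeff_msupp mcoeffM_mlast // mulf_neq0 //.
  by rewrite -mcoeff_msupp mlast_supp.
have dlead : (mdeg (mlead p) + mdeg (mlead q))%N = d.
  by rewrite -mdegD -mleadM //; apply/hpq/mlead_supp.
have := lemc_mdeg (mlast_lemc (mlead_supp q0)).
rewrite dlast -dlead -{2}[mdeg (mlead q)]add0n leq_add2r leqn0 => /eqP dp.
by rewrite -mlead_deg // dp.
Qed.

Lemma dhomog_det (l n : nat) (K : idomainType) (A : 'M[{mpoly K[l]}]_n)
    (d : 'I_n -> nat) :
  (forall i j, A i j \is (d i).-homog) -> \det A \is (\sum_i d i)%N.-homog.
Proof.
move=> hA; apply: rpred_sum => s _.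
have : \prod_i A i (s i) \is (\sum_i d i)%N.-homog.
  by elim/big_rec2: _ => [|i e p _ hp]; [exact: dhomog1 | exact: dhomogM].
by rewrite mulr_sign; case: ifP => // _; rewrite rpredN.
Qed.

Definition homog_rows (K : nzRingType) (l m n : nat)
    (A : 'M[{mpoly K[l]}]_(m, n)) : Prop :=
  forall i, exists d, forall j, A i j \is d.-homog.

(** The determinant of [C *m B] is homogeneous and equals [\det C * \det B]; since [\det C] does not
    vanish at the origin, it is a nonzero constant, so [C] is invertible. *)
Lemma homog_mx_basis (K : fieldType) (l n : nat)
    (D : 'rV[{mpoly K[l]}]_n -> Prop) (B C : 'M_n) :
  mx_basis D B -> map_mx (mcoeff 0%MM) C \in unitmx ->
  (forall i, D (row i (C *m B))) -> homog_rows (C *m B) ->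
  mx_basis D (C *m B).
Proof.
move=> bB uC DCB /fin_all_exists[d hCB]; apply: mx_basis_unit => //.
have := dhomog_det hCB; rewrite det_mulmx unitmxE.
move: uC; rewrite unitmxE unitfE det_map_mx /= => c0.
move=> /(dhomog_left_factor (mx_basis_det bB) c0) ->.
by apply: (rmorph_unit (@mpolyC l K)); rewrite unitfE.
Qed.

(** The rows of [H] are the homogeneous components of the rows of [B]. From [H = C *m B] and
    [B = E *m H] follows [E *m C = 1], so [C] has full rank at the origin; [n] of its rows that are
    independent there select a basis among the components. *)
Lemma exists_homog_mx_basis (K : fieldType) (l n : nat)
    (D : 'rV[{mpoly K[l]}]_n -> Prop) (B : 'M_n) :
  (forall d x, D x -> D (map_mx (pihomog mdeg d) x)) -> mx_basis D B ->
  exists2 B' : 'M_n, mx_basis D B' & homog_rows B'.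
Proof.
move=> Dh bB; have [DB _ _] := bB.
pose N := \max_i \max_j msize (B i j).
pose T : finType := ('I_n * 'I_N)%type.
pose H : 'M_(#|T|, n) := \matrix_(k < #|T|)
  map_mx (pihomog mdeg (enum_val k).2) (row (enum_val k).1 B).
have DH k : D (row k H) by rewrite rowK; apply/Dh/DB.
have hH : homog_rows H.
  by move=> k; exists ((enum_val k).2 : 'I_N) => j; rewrite !mxE pihomogP.
have [C HE] := mx_basis_mul bB DH.
pose E : 'M[{mpoly K[l]}]_(n, #|T|) := \matrix_(i, k) ((enum_val k).1 == i)%:R.
have EHB : E *m H = B.
  apply/matrixP => i j; rewrite mxE.
  rewrite (reindex (@enum_rank T)); last exact: onW_bij (enum_rank_bij T).
  under eq_bigr do rewrite !mxE enum_rankK.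
  rewrite -(pair_bigA _ (fun x y => (x == i)%:R * pihomog mdeg (y : 'I_N) (B x j))) /=.
  rewrite (bigD1 i) //= [X in _ + X]big1 ?addr0 => [|x /negPf xi]; last first.
    by apply: big1 => y _; rewrite xi mul0r.
  under eq_bigr do rewrite eqxx mul1r.
  rewrite -pihomog_partitionE //.
  by apply: leq_trans (leq_bigmax i); apply: leq_bigmax j.
have fullC : row_full (map_mx (mcoeff 0%MM) C).
  apply/row_fullP; exists (map_mx (mcoeff 0%MM) E).
  suff EC : E *m C = 1%:M by rewrite -map_mxM EC map_mx1.
  by apply: (mulmx_det_inj (mx_basis_det bB)); rewrite -mulmxA -HE EHB mul1mx.
pose f := fullrankfun fullC.
have CBE : rowsub f C *m B = rowsub f H by rewrite HE mul_rowsub_mx.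
exists (rowsub f C *m B).
  apply: homog_mx_basis bB _ _ _.
  - by rewrite -row_full_unit map_mxsub fullrowsub_full.
  - by move=> i; rewrite CBE row_rowsub.
  - by move=> i; rewrite CBE; have [d hd] := hH (f i); exists d => j; rewrite mxE.
rewrite CBE => i; have [d hd] := hH (f i); exists d => j; rewrite mxE; exact: hd.
Qed.

(** * Matrix factorizations of a linear form *)

Lemma dhomog1_coef0 (K : nzRingType) (l : nat) (a : {mpoly K[l]}) :
  a \is 1.-homog -> a@_0 = 0.
Proof. by move=> /dhomog_nemf_coeff; apply; rewrite /= mdeg0. Qed.

(* Differentiating [M *m N = a] at the origin bounds the sum of the ranks from
   below; [M(0) *m N(0) = 0] bounds it from above. *)
Lemma rank_matrix_factorization (K : fieldType) (l n : nat) (a : {mpoly K[l]})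
    (M N : 'M[{mpoly K[l]}]_n) :
  a \is 1.-homog -> a != 0 -> M *m N = a%:M ->
  (\rank (map_mx (mcoeff 0%MM) M) + \rank (map_mx (mcoeff 0%MM) N) = n)%N.
Proof.
move=> ha a0 MN; apply/anti_leq/andP; split.
  by apply: mulmx0_rank_max; rewrite -map_mxM MN map_scalar_mx /= dhomog1_coef0 // raddf0.
(* The leading monomial of [a] is a variable; the partial derivative of [a] along it is nonzero at
   the origin. *)
have /dhomogP/(_ _ (mlead_supp a0))/eqP := ha.
rewrite /= mdeg_eq1 => /existsP[p /eqP pE].
pose ev (A : 'M[{mpoly K[l]}]_n) := map_mx (mcoeff 0%MM) A.
pose d (A : 'M[{mpoly K[l]}]_n) := map_mx (mderiv p) A.
have c0 : (a^`M(p))@_0 != 0.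
  by rewrite mcoeff_mderiv add0m mnm0E -pE -/(mleadc a) mleadc_eq0.
have dE : d (M *m N) = d M *m N + M *m d N.
  apply/matrixP => i j; rewrite !mxE linear_sum -big_split /=.
  by apply: eq_bigr => k _; rewrite !mxE mderivM.
have: ev (d (M *m N)) = ((a^`M(p))@_0)%:M.
  by apply/matrixP => i j; rewrite MN !mxE; case: eqP => //=; rewrite !raddf0.
rewrite dE /ev map_mxD !map_mxM /= => /(congr1 mxrank).
rewrite -scalemx1 mxrank_scale_nz // mxrank1 => rkE; rewrite addnC -[leqLHS]rkE.
by apply: leq_trans (mxrank_add _ _) _; rewrite leq_add ?mxrankM_maxr ?mxrankM_maxl.
Qed.

Lemma homog_rows_rowsub (K : nzRingType) (l m n p : nat) (f : 'I_p -> 'I_m)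
    (A : 'M[{mpoly K[l]}]_(m, n)) : homog_rows A -> homog_rows (rowsub f A).
Proof. by move=> hA i; have [d hd] := hA (f i); exists d => j; rewrite mxE. Qed.

Lemma homog_rows_col_mx (K : nzRingType) (l m n p : nat)
    (A : 'M[{mpoly K[l]}]_(m, n)) (B : 'M[{mpoly K[l]}]_(p, n)) :
  homog_rows A -> homog_rows B -> homog_rows (col_mx A B).
Proof.
move=> hA hB i; rewrite -(splitK i).
case: (split i) => k /=; [have [d hd] := hA k | have [d hd] := hB k];
  by exists d => j; rewrite ?col_mxEu ?col_mxEd.
Qed.

Lemma homog_rows_scale (K : comNzRingType) (l m n e : nat) (a : {mpoly K[l]})
    (A : 'M[{mpoly K[l]}]_(m, n)) :
  a \is e.-homog -> homog_rows A -> homog_rows (a *: A).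
Proof.
by move=> ha hA i; have [d hd] := hA i; exists (e + d)%N => j; rewrite mxE dhomogM.
Qed.

Lemma row_col_mx_ind (R : Type) (m n p : nat) (D : 'rV[R]_n -> Prop)
    (A : 'M[R]_(m, n)) (B : 'M[R]_(p, n)) :
  (forall i, D (row i A)) -> (forall i, D (row i B)) ->
  forall i, D (row i (col_mx A B)).
Proof.
by move=> DA DB i; rewrite -(splitK i); case: (split i) => k /=; rewrite ?rowKu ?rowKd.
Qed.

(** Multiplying the relation by [N] kills the part in [X] and yields [v = 0]; then [u = 0] since [X]
    is row free. *)
Lemma row_free_independent (K : fieldType) (r s n p : nat) (X : 'M[K]_(r, n))
    (Y : 'M_(s, n)) (N : 'M_(n, p)) (u : 'rV_r) (v : 'rV_s) :
  X *m N = 0 -> row_free X -> row_free (Y *m N) -> u *m X + v *m Y = 0 ->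
  u = 0 /\ v = 0.
Proof.
move=> XN0 frX frYN uv0.
have /eqP : v *m (Y *m N) = 0.
  move/(congr1 (mulmx^~ N)): uv0.
  by rewrite mulmxDl mul0mx -!mulmxA XN0 mulmx0 add0r.
rewrite mulmx_free_eq0 // => /eqP v0; move/eqP: uv0.
by rewrite v0 mul0mx addr0 mulmx_free_eq0 // => /eqP ->.
Qed.

Lemma rowsub0 (V : nmodType) (m n p : nat) (f : 'I_p -> 'I_m) :
  rowsub f (0 : 'M[V]_(m, n)) = 0.
Proof. by apply/matrixP => i j; rewrite !mxE. Qed.

Section MatrixFactorizationBases.

Variables (K : fieldType) (l : nat) (a : {mpoly K[l]}).
Local Notation S := {mpoly K[l]}.
Hypotheses (ha : a \is 1.-homog) (a0 : a != 0).

(** The transition matrices consist of rows of [M] and of the identity, respectively of the identity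
    and of [N]. At the origin they are invertible: [M *m N] and [N *m M] vanish there, so
    [row_free_independent] applies with [M] and [N] in either role. *)
Lemma adapted_mx_bases (r s : nat) (D D' : 'rV[S]_(r + s) -> Prop)
    (B B' M N : 'M_(r + s)) (f : 'I_r -> 'I_(r + s)) (g : 'I_s -> 'I_(r + s)) :
  (forall x, D x -> D' x) -> (forall x, D' x -> D (a *: x)) ->
  mx_basis D B -> homog_rows B -> mx_basis D' B' -> homog_rows B' ->
  M *m B' = B -> N *m B = a *: B' -> M *m N = a%:M -> N *m M = a%:M ->
  row_free (rowsub f (map_mx (mcoeff 0%MM) M)) ->
  row_free (rowsub g (map_mx (mcoeff 0%MM) N)) ->
  mx_basis D' (col_mx (rowsub f B) (rowsub g B')) /\
  mx_basis D (col_mx (rowsub f B) (a *: rowsub g B')).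
Proof.
move=> DD' aD' bB hB bB' hB' MB' NB MN NM frM frN.
have [DB _ _] := bB; have [DB' _ _] := bB'.
have ev0 : map_mx (mcoeff 0%MM) (a%:M : 'M_(r + s)) = 0.
  by rewrite map_scalar_mx /= dhomog1_coef0 // raddf0.
have MN0 : map_mx (mcoeff 0%MM) M *m map_mx (mcoeff 0%MM) N = 0.
  by rewrite -map_mxM MN.
have NM0 : map_mx (mcoeff 0%MM) N *m map_mx (mcoeff 0%MM) M = 0.
  by rewrite -map_mxM NM.
split.
- have CE : col_mx (rowsub f M) (rowsub g 1%:M) *m B' =
      col_mx (rowsub f B) (rowsub g B').
    by rewrite mul_col_mx !mul_rowsub_mx MB' mul1mx.
  rewrite -CE; apply: homog_mx_basis => //; rewrite ?CE.
  + rewrite map_col_mx !map_mxsub map_mx1 -row_free_unit.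
    apply: inj_row_free => v; rewrite -[v]hsubmxK mul_row_col => v0.
    have [| | -> ->] := row_free_independent (N := map_mx (mcoeff 0%MM) N) _ frM _ v0.
    * by rewrite mul_rowsub_mx MN0 rowsub0.
    * by rewrite mul_rowsub_mx mul1mx.
    * by rewrite row_mx0.
  + by apply: row_col_mx_ind => i; rewrite row_rowsub //; apply: DD'.
  + by apply: homog_rows_col_mx; apply: homog_rows_rowsub.
- have CE : col_mx (rowsub f 1%:M) (rowsub g N) *m B =
      col_mx (rowsub f B) (a *: rowsub g B').
    rewrite mul_col_mx !mul_rowsub_mx mul1mx NB; congr col_mx.
    by apply/matrixP => i j; rewrite !mxE.
  rewrite -CE; apply: homog_mx_basis => //; rewrite ?CE.
  + rewrite map_col_mx !map_mxsub map_mx1 -row_free_unit.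
    apply: inj_row_free => v; rewrite -[v]hsubmxK mul_row_col addrC => v0.
    have [| | -> ->] := row_free_independent (N := map_mx (mcoeff 0%MM) M) _ frN _ v0.
    * by rewrite mul_rowsub_mx NM0 rowsub0.
    * by rewrite mul_rowsub_mx mul1mx.
    * by rewrite row_mx0.
  + apply: row_col_mx_ind => i; first by rewrite row_rowsub.
    by rewrite linearZ /= row_rowsub; apply/aD'/DB'.
  + apply: homog_rows_col_mx; first exact: homog_rows_rowsub.
    by apply: (homog_rows_scale ha); apply: homog_rows_rowsub.
Qed.

(* The last hypothesis says that [D' / D] embeds in [S / a] as an ideal, [b] and
   [- c] being representatives of the images of [y] and [x]. *)
Lemma deletion_bases (n : nat) (D D' : 'rV[S]_n -> Prop) (B B' : 'M_n) :
  (forall x, D x -> D' x) -> (forall x, D' x -> D (a *: x)) ->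
  mx_basis D B -> homog_rows B -> mx_basis D' B' -> homog_rows B' ->
  (forall C : 'M_n, mx_basis D C -> ~ mx_basis D' C) ->
  (forall x y, D' x -> D' y -> exists b c,
    D (b *: x + c *: y) /\ ((exists h, c = a * h) -> D x)) ->
  exists (T : 'M_n) (k : 'I_n), mx_basis D' T /\
    mx_basis D (\matrix_i (if i == k then a *: row i T else row i T)).
Proof.
move=> DD' aD' bB hB bB' hB' hneq hrel.
have [DB _ _] := bB; have [DB' _ _] := bB'.
have [M MB] : exists M : 'M_n, B = M *m B'.
  by apply: mx_basis_mul bB' _ => i; apply/DD'/DB.
have [N NB] : exists N : 'M_n, a *: B' = N *m B.
  by apply: mx_basis_mul bB _ => i; rewrite linearZ; apply/aD'/DB'.
have MN : M *m N = a%:M.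
  apply: (mulmx_det_inj (mx_basis_det bB)).
  by rewrite -mulmxA -NB -scalemxAr -MB mul_scalar_mx.
have NM : N *m M = a%:M.
  apply: (mulmx_det_inj (mx_basis_det bB')).
  by rewrite -mulmxA -MB -NB mul_scalar_mx.
have := rank_matrix_factorization ha a0 MN.
have := maxrowsub_free (map_mx (mcoeff 0%MM) M).
have := maxrowsub_free (map_mx (mcoeff 0%MM) N).
move: (maxrankfun _) (maxrankfun _).
move: (\rank (map_mx _ N)) (\rank (map_mx _ M)) => s r f g frN frM nE.
subst n.
have [bT bT'] := adapted_mx_bases DD' aD' bB hB bB' hB' (esym MB) (esym NB) MN NM frM frN.
(* If [s = 0], the two adapted bases coincide, against [hneq]; [s = 1] is the claim; [s >= 2] is
   refuted through [hrel]. *)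
case: s => [|[|s]] in D D' B B' M N f g frM frN DD' aD' bB hB bB' hB' hneq hrel
  DB DB' MB NB MN NM bT bT' *.
- case: (hneq _ bT'); congr (mx_basis D' (col_mx _ _)): bT.
  by rewrite [LHS]flatmx0 [RHS]flatmx0.
- exists (col_mx (rowsub f B) (rowsub g B')), (rshift r ord0); split=> //.
  congr (mx_basis D _): bT'; apply/row_matrixP => i; rewrite rowK.
  rewrite -(splitK i); case: (split i) => k /=.
    by rewrite !rowKu eq_lrshift.
  by rewrite !rowKd (ord1 k) eqxx linearZ.
- exfalso.
  have D'g i : D' (row i (rowsub g B')) by rewrite row_rowsub.
  have [_ _ frT] := bT; have [_ genT' _] := bT'.
  (* Comparing coordinates in the two adapted bases: a combination of the rows of [rowsub g B'] that
     lies in [D] has all its coefficients divisible by [a]. *)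
  have coordT (w : 'rV_s.+2) x : D x -> x = w *m rowsub g B' ->
      exists h : 'rV_s.+2, w = a *: h.
    move=> /genT'[c ->]; rewrite -[c]hsubmxK mul_row_col -scalemxAr scalemxAl.
    move=> cE; exists (rsubmx c); apply/eqP; rewrite -subr_eq0 -opprB oppr_eq0.
    have /frT/eqP : row_mx (lsubmx c) (a *: rsubmx c - w) *m
        col_mx (rowsub f B) (rowsub g B') = 0.
      by rewrite mul_row_col mulmxBl addrA cE subrr.
    by rewrite row_mx_eq0 => /andP[_].
  have Dg i : ~ D (row i (rowsub g B')).
    move=> /coordT/(_ (rowE _ _))[h /rowP/(_ i)]; rewrite !mxE !eqxx /=.
    move/(congr1 (mcoeff 0%MM)); rewrite rmorphM /= (dhomog1_coef0 ha) mul0r.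
    by rewrite mcoeff1 eqxx => /eqP; rewrite oner_eq0.
  (* For two distinct rows, the relation lies in [D], so [a] divides [c]; this puts the first row in
     [D], contradicting [Dg]. *)
  have [b [c [Dbc aDvd]]] := hrel _ _ (D'g ord0) (D'g ord_max).
  apply: (Dg ord0); apply: aDvd.
  have [|h /rowP/(_ ord_max)] := coordT (b *: delta_mx 0 ord0 + c *: delta_mx 0 ord_max) _ Dbc.
    by rewrite !rowE mulmxDl !scalemxAl.
  by rewrite !mxE !eqxx /= mulr0 add0r mulr1 => ->; exists (h 0 ord_max).
Qed.
End MatrixFactorizationBases.

(** * Logarithmic derivations *)

Lemma is_basis_iff (R : nzRingType) (M : lmodType R) (D D' : M -> Prop)
    (I : eqType) (b : I -> M) :
  (forall x, D x <-> D' x) -> is_basis D b -> is_basis D' b.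
Proof.
move=> DD' [Db gen fr]; split=> // [i | x]; first exact/DD'.
by move/DD'; apply: gen.
Qed.

Lemma pihomog_dhomogM (K : comNzRingType) (l d e : nat) (p g : {mpoly K[l]}) :
  p \is e.-homog -> exists g', pihomog mdeg d (p * g) = p * g'.
Proof.
(* The cofactor is the component of [g] in degree [d - e]; as a filtered sum it is zero when
   [d < e]. *)
move=> hp; exists (\sum_(j < msize g | (e + j)%N == d) pihomog mdeg j g).
rewrite {1}(@pihomog_partitionE _ _ mdeg _ g (leqnn _)) !mulr_sumr linear_sum /=.
rewrite [RHS]big_mkcond /=; apply: eq_bigr => j _.
have hpg : p * pihomog mdeg j g \is (e + j).-homog.
  by apply: dhomogM => //; apply: pihomogP.
by case: eqP => [<- | /eqP ne]; [rewrite pihomog_dE | rewrite (pihomog_ne0 ne)].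
Qed.

Lemma der_appD (K : fieldType) (l : nat) (p : {mpoly K[l]})
    (x y : 'rV[{mpoly K[l]}]_l) (f : {mpoly K[l]}) :
  der_app (p *: x + y) f = p * der_app x f + der_app y f.
Proof.
rewrite /der_app mulr_sumr -big_split; apply: eq_bigr => i _.
by rewrite !mxE mulrDl mulrA.
Qed.

(** * Linear forms as homogeneous polynomials of degree one *)

Section LinearForms.

Variables (K : fieldType) (V : vectType K) (l : nat) (e : l.-tuple V).
Hypothesis he : basis_of {:V} e.
Implicit Types a b : 'Hom(V, K^o).
Local Notation S := {mpoly K[l]}.

Lemma mcoeff_form_poly a (i : 'I_l) : (form_poly e a)@_U_(i) = a (tnth e i).
Proof.
rewrite /form_poly linear_sum /= (bigD1 i) //= mcoeffZ mcoeffXU eqxx mulr1.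
rewrite big1 ?addr0 // => j /negPf ji.
by rewrite mcoeffZ mcoeffXU ji mulr0.
Qed.

Lemma mderiv_form_poly a (i : 'I_l) :
  (form_poly e a)^`M(i) = (a (tnth e i) : K)%:MP.
Proof.
rewrite /form_poly linear_sum /= (bigD1 i) //= mderivZ mderivX mnm1E eqxx.
rewrite [X in _ + X]big1 ?addr0 => [|j /negPf ji]; last first.
  by rewrite mderivZ mderivX mnm1E ji scale0r scaler0.
by rewrite scale1r -{1}[U_(i)%MM]add0m addmK mpolyX0 -mul_mpolyC mulr1.
Qed.

Lemma dhomog_form_poly a : form_poly e a \is 1.-homog.
Proof. by apply: rpred_sum => i _; apply: rpredZ; rewrite dhomogX /= mdeg1. Qed.

Lemma form_poly_scale a b (c : K) :
  form_poly e b = c *: form_poly e a -> forall v, b v = c * a v :> K.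
Proof.
move=> bE v; rewrite (coord_basis he (memvf v)) !linear_sum mulr_sumr.
apply: eq_bigr => i _; rewrite !linearZ /= mulrCA; congr (_ * _).
by rewrite -tnth_nth -mcoeff_form_poly bE mcoeffZ mcoeff_form_poly.
Qed.

Lemma form_poly_neq0 a : (\dim (lker a)).+1 = \dim {:V} -> form_poly e a != 0.
Proof.
move=> dima; apply/eqP => a0; move: dima.
suff -> : lker a = fullv by move/eqP; rewrite eqn_leq ltnn.
apply/eqP; rewrite eqEsubv subvf; apply/subvP => v _; rewrite memv_ker.
have := @form_poly_scale 0 a 0; rewrite scale0r => /(_ a0 v) ->.
by rewrite mul0r.
Qed.

Lemma form_poly_coef a : form_poly e a != 0 -> exists i, a (tnth e i) != 0.
Proof.
move=> a0; apply/existsP; apply: contra_neqT a0; rewrite negb_exists => /forallP a0.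
by apply: big1 => i _; rewrite (eqP (negbNE (a0 i))) scale0r.
Qed.

Lemma form_poly_proportional a b (c : K) :
  (\dim (lker a)).+1 = \dim {:V} -> (\dim (lker b)).+1 = \dim {:V} ->
  form_poly e b = c *: form_poly e a -> lker b = lker a.
Proof.
move=> dima dimb /form_poly_scale bE; apply/esym/eqP; rewrite eqEdim.
apply/andP; split; last by rewrite -ltnS dima dimb.
by apply/subvP => v; rewrite !memv_ker bE => /eqP ->; rewrite mulr0.
Qed.

(* The substitution [x_i |-> x_i - a / a_i] has kernel [(a)], so that its image
   is a copy of [S / a] inside the domain [S]; hence linear forms are prime. *)
Lemma exists_killing_morphism a : form_poly e a != 0 ->
  exists r : {rmorphism S -> S}, r (form_poly e a) = 0 /\
    forall b, r (form_poly e b) = 0 ->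
      exists c : K, form_poly e b = c *: form_poly e a.
Proof.
case/form_poly_coef=> p ap.
pose c : K := (a (tnth e p) : K)^-1.
pose lq := [tuple 'X_i - (if i == p then c else 0) *: form_poly e a | i < l].
(* The substitution subtracts from a linear form the multiple of [form_poly e a] that cancels its
   coefficient at [p]. *)
have rE b : form_poly e b \mPo lq =
    form_poly e b - (b (tnth e p) * c) *: form_poly e a.
  rewrite /form_poly linear_sum /=.
  under eq_bigr => i _ do
    rewrite linearZ /= comp_mpolyXU -tnth_nth tnth_mktuple scalerBr scalerA.
  rewrite sumrB -/(form_poly e a) -scaler_suml; congr (_ - _ *: _).
  rewrite (bigD1 p) //= eqxx big1 ?addr0 // => i /negPf ->; exact: mulr0.
exists (comp_mpoly lq); split; first by rewrite /= rE mulfV // scale1r subrr.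
by move=> b /=; rewrite rE => /eqP; rewrite subr_eq0 => /eqP bE; eexists; exact: bE.
Qed.

End LinearForms.

(** * The module of a multiarrangement and that of its deletion *)

Section LogarithmicDerivations.

Variables (K : fieldType) (V : vectType K) (l : nat) (e : l.-tuple V).
Variables (alpha : {vspace V} -> 'Hom(V, K^o)) (A : {fset {vspace V}}).
Implicit Type m : {vspace V} -> nat.
Local Notation S := {mpoly K[l]}.
Local Notation form H := (form_poly e (alpha H)).

Lemma logderD m (p : S) (x y : 'rV[S]_l) :
  logder e alpha A m x -> logder e alpha A m y ->
  logder e alpha A m (p *: x + y).
Proof.
move=> Dx Dy H HA; have [g gE] := Dx H HA; have [h hE] := Dy H HA.
by exists (p * g + h); rewrite der_appD gE hE mulrDr mulrCA.
Qed.

Lemma der_app0 (f : S) : der_app 0 f = 0.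
Proof. by apply: big1 => i _; rewrite mxE mul0r. Qed.

Lemma logder0 m : logder e alpha A m 0.
Proof. by move=> H HA; exists 0; rewrite der_app0 mulr0. Qed.

Lemma logder_mulmx m n (c : 'rV[S]_n) (B : 'M_(n, l)) :
  (forall i, logder e alpha A m (row i B)) -> logder e alpha A m (c *m B).
Proof.
move=> DB; rewrite mulmx_sum_row.
elim/big_ind: _ => [|x y Dx Dy|i _]; first exact: logder0.
  by rewrite -[x]scale1r; apply: logderD.
by rewrite -[_ *: _]addr0; apply: logderD (DB i) (logder0 m).
Qed.

(** A linear form has constant partial derivatives, so applying a derivation to it commutes with
    taking homogeneous components. *)
Lemma logder_homog m d x :
  logder e alpha A m x -> logder e alpha A m (map_mx (pihomog mdeg d) x).
Proof.
move=> Dx H HA; have [g gE] := Dx H HA.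
have [g' g'E] := pihomog_dhomogM d g
  (dhomogMn (m H) (dhomog_form_poly e (alpha H))).
exists g'; rewrite -g'E -gE /der_app linear_sum /=.
apply: eq_bigr => i _.
by rewrite mxE mderiv_form_poly mulrC mul_mpolyC -linearZ /= -mul_mpolyC mulrC.
Qed.

Lemma logder_leq m m' x : (forall H, H \in A -> (m' H <= m H)%N) ->
  logder e alpha A m x -> logder e alpha A m' x.
Proof.
move=> lemm Dx H HA; have [g ->] := Dx H HA.
by exists (form H ^+ (m H - m' H) * g); rewrite mulrA -exprD subnKC // lemm.
Qed.

Definition defining_poly m : S := \prod_(H <- A) form H ^+ m H.

(** This supplies the nonzero multiple of the free module of rank [l] on which [is_free_mx_basis]
    rests. *)
Lemma logder_defining_poly m x : logder e alpha A m (defining_poly m *: x).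
Proof.
move=> H HA; rewrite -[_ *: x]addr0 der_appD der_app0 addr0.
rewrite /defining_poly (bigD1_seq H) ?fset_uniq //= -mulrA.
by eexists.
Qed.

Lemma defining_poly_neq0 m :
  (forall H, H \in A -> form H != 0) -> defining_poly m != 0.
Proof.
move=> form0; rewrite /defining_poly prodf_seq_neq0; apply/allP => H HA /=.
by rewrite expf_neq0 ?form0.
Qed.

Variable H0 : {vspace V}.
Hypothesis hH0 : H0 \in A.

(** Multiplicity zero at [H0] imposes no condition, so the arrangement can be kept fixed and only
    the multiplicity lowered. *)
Lemma logder_del_arr m x : (0 < m H0)%N ->
  logder e alpha (del_arr A m H0) (del_mult m H0) x <->
  logder e alpha A (del_mult m H0) x.
Proof.
move=> m0; rewrite /del_arr; case: eqP => [mE | //]; split=> Dx H.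
  move=> HA; have [->|HH0] := eqVneq H H0.
    rewrite /del_mult eqxx mE expr0.
    by eexists; rewrite mul1r.
  by apply: Dx; rewrite !inE HH0.
by rewrite !inE => /andP[_]; apply: Dx.
Qed.

Lemma logder_del_mult m x : (0 < m H0)%N ->
  logder e alpha A m x <-> logder e alpha A (del_mult m H0) x /\
    exists g, der_app x (form H0) = form H0 ^+ m H0 * g.
Proof.
move=> m0; split=> [Dx | [Dx Dx0] H HA].
  split; last exact: Dx.
  apply: logder_leq Dx => H _; rewrite /del_mult.
  by case: eqP => [-> | //]; apply: leq_pred.
have [-> //|HH0] := eqVneq H H0.
by have := Dx H HA; rewrite /del_mult (negPf HH0).
Qed.

Lemma logder_del_multZ m x : (0 < m H0)%N ->
  logder e alpha A (del_mult m H0) x -> logder e alpha A m (form H0 *: x).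
Proof.
move=> m0 Dx; rewrite -[_ *: x]addr0; apply/logder_del_mult => //; split.
  by apply: logderD => //; apply: logder0.
have [g] := Dx H0 hH0; rewrite der_appD der_app0 addr0 => ->.
by exists g; rewrite /del_mult eqxx mulrA -exprS prednK.
Qed.

(** Dividing the value at the form of [H0] by its power [(m H0).-1] gives [gx] and [gy]. The
    combination [gy *: x - gx *: y] takes the value zero there, and [x] is in the smaller module
    once the form divides [gx]. *)
Lemma logder_del_mult_rank1 m x y : (0 < m H0)%N ->
  logder e alpha A (del_mult m H0) x -> logder e alpha A (del_mult m H0) y ->
  exists b c, logder e alpha A m (b *: x + c *: y) /\
    ((exists h, c = form H0 * h) -> logder e alpha A m x).
Proof.
move=> m0 Dx Dy; have [gx xE] := Dx H0 hH0; have [gy yE] := Dy H0 hH0.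
exists gy, (- gx); split.
  rewrite -[- gx *: y]addr0; apply/logder_del_mult => //; split.
    by do 2!apply: logderD => //; apply: logder0.
  exists 0; rewrite !der_appD der_app0 xE yE addr0 mulr0 mulNr.
  by rewrite mulrCA [gx * _]mulrCA (mulrC gy) subrr.
case=> h hE; apply/logder_del_mult => //; split=> //.
exists (- h); rewrite xE -[gx]opprK hE /del_mult eqxx.
by rewrite -{2}(prednK m0) exprSr !mulrN mulrA.
Qed.

Lemma defining_poly_del m : (0 < m H0)%N ->
  defining_poly (del_mult m H0) =
  form H0 ^+ (m H0).-1 * \prod_(H <- A | H != H0) form H ^+ m H.
Proof.
move=> m0; rewrite /defining_poly (bigD1_seq H0) ?fset_uniq //=.
rewrite /del_mult eqxx; congr (_ * _).
by apply: eq_bigr => H /negPf ->.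
Qed.

Hypothesis he : basis_of {:V} e.
Hypothesis dimA : forall H, H \in A -> (\dim (lker (alpha H))).+1 = \dim {:V}.
Hypothesis lkerA : forall H, H \in A -> lker (alpha H) = H.

(* If [a_p] is a nonzero coefficient of the form of [H0], then [Q' d/dx_p] lies
   in [D(A, m')] but not in [D(A, m)], [Q'] being the defining polynomial of
   [(A, m')]. *)
Lemma logder_del_neq m : (0 < m H0)%N ->
  exists2 x, logder e alpha A (del_mult m H0) x & ~ logder e alpha A m x.
Proof.
move=> m0; have form0 : form H0 != 0 by apply/(form_poly_neq0 he)/dimA.
have [p ap] := form_poly_coef form0.
exists (defining_poly (del_mult m H0) *: delta_mx 0 p).
  exact: logder_defining_poly.
move/(_ H0 hH0) => [g]; rewrite -[_ *: _]addr0 der_appD der_app0 addr0.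
have -> : der_app (delta_mx 0 p) (form H0) = (alpha H0 (tnth e p) : K)%:MP.
  rewrite /der_app (bigD1 p) //= mxE !eqxx mul1r mderiv_form_poly.
  by rewrite big1 ?addr0 // => i /negPf ip; rewrite mxE ip andbF mul0r.
(* After cancelling the power of the form of [H0], this form divides a nonzero constant times the
   product of the other powers. Applying [r], some other form is proportional to it, so two distinct
   hyperplanes would coincide. *)
rewrite defining_poly_del // -{2}(prednK m0) exprSr -!mulrA.
move/(mulfI (expf_neq0 _ form0)).
have [r [r0 rker]] := exists_killing_morphism form0.
move/(congr1 r); rewrite !rmorphM /= r0 mul0r => /eqP.
rewrite mulf_eq0 => /orP[|]; last first.
  move/eqP => rc; have : r ((alpha H0 (tnth e p) : K)%:MP * ((alpha H0 (tnth e p) : K)^-1)%:MP) = 0.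
    by rewrite rmorphM /= rc mul0r.
  by rewrite -mpolyCM mulfV // rmorph1 => /eqP; rewrite oner_eq0.
rewrite rmorph_prod prodf_seq_eq0 => /hasP[H HA /andP[HH0]].
rewrite rmorphXn expf_eq0 => /andP[_ /eqP/rker[c]].
move/(form_poly_proportional he (dimA hH0) (dimA HA)).
by rewrite !lkerA // => HE; rewrite HE eqxx in HH0.
Qed.

End LogarithmicDerivations.

Theorem theorem0p4 (K : fieldType) (V : vectType K) (l : nat)
    (hl : (2 <= l)%N) (e : l.-tuple V) (he : basis_of {:V} e)
    (A : {fset {vspace V}}) (m : {vspace V} -> nat)
    (alpha : {vspace V} -> 'Hom(V, K^o)) (H0 : {vspace V})
    (hA : is_multiarrangement A m) (halpha : defining_forms A alpha)
    (hH0 : H0 \in A)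
    (hfree : is_free (logder e alpha A m))
    (hfree' : is_free (logder e alpha (del_arr A m H0) (del_mult m H0))) :
  exists theta : 'I_l -> 'rV[{mpoly K[l]}]_l,
    is_basis (logder e alpha (del_arr A m H0) (del_mult m H0)) theta /\
    exists k : 'I_l,
      is_basis (logder e alpha A m)
        (fun i => if i == k then form_poly e (alpha H0) *: theta i
                  else theta i).
Proof.
have [_ m0] := hA _ hH0.
have dimA H : H \in A -> (\dim (lker (alpha H))).+1 = \dim {:V}.
  by move=> HA; rewrite halpha //; case: (hA H HA).
have form0 H : H \in A -> form_poly e (alpha H) != 0.
  by move=> /dimA; apply: form_poly_neq0.
have delE x := logder_del_arr e alpha A x m0.
have homog_basis m' : is_free (logder e alpha A m') ->
    exists2 B, mx_basis (logder e alpha A m') B & homog_rows B.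
  case/(is_free_mx_basis (defining_poly_neq0 m' form0))=> [i | B].
    exact: logder_defining_poly.
  by apply: exists_homog_mx_basis => d x; apply: logder_homog.
have [B bB hB] := homog_basis _ hfree.
have [B' bB' hB'] : exists2 B', mx_basis (logder e alpha A (del_mult m H0)) B' &
    homog_rows B'.
  by apply: homog_basis; case: hfree' => I [b /(is_basis_iff delE) bb]; exists I, b.
have [||C [DC _ _] [_ genC _]|x y|T [k [bT' bT]]] :=
  deletion_bases (dhomog_form_poly e (alpha H0)) (form0 _ hH0) _ _ bB hB bB' hB'.
- by move=> x /(logder_del_mult e alpha hH0 x m0)[].
- by move=> x; apply: logder_del_multZ.
(* A common basis would make every element of the larger module a combination of elements of the
   smaller one. *)
- have [x /genC[c ->]] := logder_del_neq hH0 he dimA halpha m0.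
  by apply; apply: logder_mulmx.
- exact: logder_del_mult_rank1.
exists (fun i => row i T); split.
  by apply: (is_basis_iff (fun x => iff_sym (delE x))); apply: mx_basis_is_basis bT' _.
by exists k; apply: mx_basis_is_basis bT _ => i; rewrite rowK.
Qed.
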